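(* Let $X,Y,Z$ be real normed linear spaces, let $A\subset X$ and $B\subset Y$ be open convex sets, and let $F\colon A\to B$ and $G\colon B\to Z$ be d.c. mappings. Then $G\circ F$ is d.c. on $A$, provided at least one of the following conditions is satisfied: (a) $B=Y$ and $G$ admits a control function $g$ that is bounded on bounded sets; (b) $Y$ is finite-dimensional and $\overline{F(A)}\subset B$; (c) $Y$ admits an equivalent norm with modulus of convexity of power type 2, and $G$ is $C^{1,1}$ on bounded open subsets of $B$.
   Context: Let $X,Y$ be real normed linear spaces and $C\subset X$ convex. A continuous mapping $F\colon C\to Y$ is called d.c. (delta-convex) if there is a continuous function $f\colon C\to\mathbb{R}$ such that $y^*\circ F+f$ is convex on $C$ for every $y^*\in Y^*$ with $\|y^*\|\le 1$; such an $f$ is called a control function for $F$. A normed linear space $X$ has modulus of convexity of power type 2 if there is $a>0$ with $\delta_X(\varepsilon)\ge a\varepsilon^2$ for each $\varepsilon\in(0,2]$, where $\delta_X(\varepsilon)=\inf\{1-\|\tfrac{x+y}{2}\|:\|x\|\le1,\|y\|\le1,\|x-y\|\ge\varepsilon\}$ is the classical modulus of convexity. A mapping $F\colon U\to Y$ on an open set $U\subset X$ is $C^{1,1}$ on $U$ if its Fréchet derivative $F'(x)$ exists at each $x\in U$ and $F'\colon U\to\mathcal{L}(X,Y)$ is Lipschitz. *)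

(* Defs.v *)
From HB Require Import structures.
From mathcomp Require Import all_boot all_order all_algebra.
From mathcomp Require Import all_classical all_reals all_analysis.

Set Implicit Arguments.
Unset Strict Implicit.
Unset Printing Implicit Defensive.

Import Order.TTheory GRing.Theory Num.Theory.
Import numFieldNormedType.Exports.

Local Open Scope classical_set_scope.
Local Open Scope ring_scope.

(* A map with domain C `<=` X is represented by a total function on X whose
   values outside C play no role: continuity is that of the restriction to C,
   and convexity inequalities only involve points of C. *)

(* For a continuous linear T this is the operator norm; for an unbounded T the
   real-valued [sup] has a default value, so [op_norm] is only used on
   continuous linear maps. *)
Definition op_norm (R : realType) (V W : normedModType R) (T : V -> W) : R :=
  sup [set `|T v| | v in [set v : V | `|v| <= 1]].

Definition control_function (R : realType) (X Y : normedModType R)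
    (C : set X) (F : X -> Y) (f : X -> R^o) : Prop :=
  {within C, continuous f} /\
  forall ystar : {linear Y -> R^o}, continuous ystar -> op_norm ystar <= 1 ->
    convex_function (C : set (convex_lmodType X)) (fun x => ystar (F x) + f x).

Definition delta_convex (R : realType) (X Y : normedModType R)
    (C : set X) (F : X -> Y) : Prop :=
  {within C, continuous F} /\ exists f : X -> R^o, control_function C F f.

Definition bounded_on_bounded_sets (R : realType) (Y : normedModType R)
    (g : Y -> R^o) : Prop :=
  forall S : set Y, bounded_set S -> [bounded g y | y in S].

Definition finite_dimensional (R : realType) (Y : lmodType R) : Prop :=
  exists (n : nat) (e : 'I_n -> Y),
    forall y : Y, exists c : 'I_n -> R, y = \sum_(i < n) c i *: e i.

Definition equivalent_norm (R : realType) (Y : normedModType R)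
    (N : Y -> R) : Prop :=
  [/\ forall y, N y = 0 -> y = 0,
      forall (k : R) y, N (k *: y) = `|k| * N y,
      forall x y, N (x + y) <= N x + N y
    & exists c C : R, [/\ 0 < c, 0 < C &
        forall y, c * `|y| <= N y /\ N y <= C * `|y|]].

(* The infimum is taken in the extended reals, so that it is +oo when no pair
   (x, y) is admissible (i.e. when Y is the zero space). *)
Definition modulus_of_convexity (R : realType) (Y : lmodType R)
    (N : Y -> R) (eps : R) : \bar R :=
  ereal_inf [set (1 - N (2^-1 *: (p.1 + p.2)))%:E | p in
    [set p : Y * Y | [/\ N p.1 <= 1, N p.2 <= 1 & eps <= N (p.1 - p.2)]]].

Definition modulus_power_type2 (R : realType) (Y : lmodType R)
    (N : Y -> R) : Prop :=
  exists2 a : R, 0 < a &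
    forall eps : R, 0 < eps -> eps <= 2 ->
      ((a * eps ^+ 2)%:E <= modulus_of_convexity N eps)%E.

Definition C11_on (R : realType) (Y Z : normedModType R)
    (U : set Y) (G : Y -> Z) : Prop :=
  (forall x, U x -> differentiable G x) /\
  exists L : R, forall x y, U x -> U y ->
    op_norm (fun h => 'd G x h - 'd G y h) <= L * `|x - y|.

(* Main.v *)
(* Write [J_h = s h(x) + t h(y) - h(s x + t y)] for the Jensen gap of [h], with
   [s + t = 1]. By Hahn-Banach, [f] controls [F] exactly when [|J_F| <= J_f].
   If [k = z* o G + g] is convex on [B] and admits at [b = F(s x + t y)] the
   minorant [k(b) - L |. - b|], then [J_(k o F) >= - L J_f]. The constant [L] only
   depends on [b], so it suffices to bound it by a function of some convex
   [p >= |F|] with [J_p >= J_f]; one may take [p = f + K + C |x|], and for a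
   convex [psi] on the line whose slope at [p] exceeds [L], the function
   [g o F + psi o p] controls [G o F].

   In case (a), [k] is bounded above on bounded sets; in case (b), [L] is locally
   bounded and bounded subsets of [closure (F(A))] are relatively compact in [B].
   In case (c), the square of the uniformly convex norm [N] has Jensen gap at
   least [c (s N(x - w)^2 + t N(y - w)^2)], [w = s x + t y], which absorbs the
   Taylor remainders of [G]; hence [G] has a control function [psi o N^2] for
   which [L] is bounded on bounded sets. *)
Require Import Defs.
From HB Require Import structures.
From mathcomp Require Import all_boot all_order all_algebra.
From mathcomp Require Import all_classical all_reals all_analysis.
From mathcomp Require Import ring lra.

Set Implicit Arguments.
Unset Strict Implicit.
Unset Printing Implicit Defensive.

Import Order.TTheory GRing.Theory Num.Theory.
Import numFieldNormedType.Exports.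

Local Open Scope classical_set_scope.
Local Open Scope ring_scope.

(** * Norming functionals *)

(** Homogeneity is an inequality for [t > 0], a form easily checked for infima; [sublinearZ]
    recovers equality. *)
Definition sublinear (R : realType) (V : lmodType R) (p : V -> R) : Prop :=
  (forall x y, p (x + y) <= p x + p y) /\
  (forall (t : R) x, 0 < t -> p (t *: x) <= t * p x).

Lemma sublinearZ (R : realType) (V : lmodType R) (p : V -> R) (t : R) (x : V) :
  sublinear p -> 0 <= t -> p (t *: x) = t * p x.
Proof.
move=> [_ pZ]; rewrite le_eqVlt => /predU1P[<-|t0].
  rewrite scale0r mul0r.
  (* [p 0 <= 2 * p 0] and [p 0 <= p 0 / 2] force [p 0 = 0]. *)
  have := pZ 2 0 ltac:(lra); have := pZ 2^-1 0 ltac:(lra); rewrite !scaler0.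
  by move=> h1 h2; lra.
apply/eqP; rewrite eq_le pZ//= -ler_pdivlMl//.
by rewrite -{1}[x](scalerK (lt0r_neq0 t0)) pZ// invr_gt0.
Qed.

Lemma sublinear0 (R : realType) (V : lmodType R) (p : V -> R) :
  sublinear p -> p 0 = 0.
Proof. by move=> sp; rewrite -(scale0r 0) (sublinearZ _ sp)// mul0r. Qed.

Lemma sublinearN (R : realType) (V : lmodType R) (p : V -> R) (x : V) :
  sublinear p -> - p (- x) <= p x.
Proof.
by move=> sp; have := sp.1 x (- x); rewrite subrr sublinear0//; lra.
Qed.

(* Forces additivity in the direction [v]: a sublinear minorant of [p] whose
   value at [- v] is at most [- p v]. *)
Lemma sublinear_step (R : realType) (V : lmodType R) (p : V -> R) (v : V) :
  sublinear p ->
  exists q : V -> R, [/\ sublinear q, forall x, q x <= p x &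
    forall x, q x <= p (x + v) - p v].
Proof.
(* The new functional is [inf (S x)]: [t = 0] puts it below [p], [t = 1] gives the last claim. *)
move=> sp; pose S x := [set p (x + t *: v) - t * p v | t in [set t : R | 0 <= t]].
have S0 x : S x !=set0 by exists (p (x + 0 *: v) - 0 * p v), 0 => /=.
have lbS x : lbound (S x) (- p (- x)).
  move=> _ [t /= t0 <-]; rewrite -(sublinearZ _ sp)//.
  have := sp.1 (x + t *: v) (- x); rewrite addrAC subrr add0r; lra.
have infS x t : 0 <= t -> inf (S x) <= p (x + t *: v) - t * p v.
  by move=> t0; apply: ge_inf; [exists (- p (- x)); exact: lbS|exists t].
exists (fun x => inf (S x)); split; [split| |].
- move=> x y; rewrite -lerBlDr; apply: lb_le_inf => // _ [s /= s0 <-].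
  rewrite lerBlDr -lerBlDl; apply: lb_le_inf => // _ [t /= t0 <-].
  rewrite lerBlDl; apply: le_trans (infS _ _ (addr_ge0 s0 t0)) _.
  have := sp.1 (x + s *: v) (y + t *: v).
  by rewrite scalerDl addrACA; lra.
- move=> t x t0; rewrite -ler_pdivrMl//; apply: lb_le_inf => // _ [s /= s0 <-].
  rewrite ler_pdivrMl//.
  apply: le_trans (infS _ (t * s) (mulr_ge0 (ltW t0) s0)) _.
  by rewrite -scalerA -scalerDr (sublinearZ _ sp) ?(ltW t0)//; lra.
- by move=> x; apply: le_trans (infS x 0 _) _; rewrite // scale0r addr0; lra.
- by move=> x; have := infS x 1 ler01; rewrite scale1r mul1r.
Qed.

(** Zorn's lemma for the reversed pointwise order: a nonempty chain is bounded by its pointwise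
    infimum, finite since each member is at least [- p (- x)] at [x]. *)
Lemma minimal_sublinear (R : realType) (V : lmodType R) (p : V -> R) :
  sublinear p ->
  exists q : V -> R, [/\ sublinear q, forall x, q x <= p x &
    forall r : V -> R, sublinear r -> (forall x, r x <= q x) ->
      forall x, q x <= r x].
Proof.
move=> sp.
have t0 : {q : V -> R | sublinear q /\ forall x, q x <= p x} by exists p.
pose r (a b : {q : V -> R | sublinear q /\ forall x, q x <= p x}) :=
  `[< forall x, sval b x <= sval a x >].
have [||C totC|[q [sq qp]] qmin] := @ZL_preorder _ t0 r.
- by move=> a; apply/asboolP.
- move=> a b c /asboolP ba /asboolP cb; apply/asboolP => x.
  exact: le_trans (cb x) (ba x).
- have [C0|/set0P[c0 Cc0]] := eqVneq C set0; first by exists t0; rewrite C0.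
  pose S x := [set sval c x | c in C].
  have S0 x : S x !=set0 by exists (sval c0 x), c0.
  have lbS x : lbound (S x) (- p (- x)).
    move=> _ [[c [sc cp]] _ <-] /=; apply: le_trans (sublinearN _ sc).
    by rewrite lerN2.
  have infS x c : C c -> inf (S x) <= sval c x.
    by move=> Cc; apply: ge_inf; [exists (- p (- x)); exact: lbS|exists c].
  have sq : sublinear (fun x => inf (S x)).
    split=> [x y|t x t0'].
      rewrite -lerBlDr; apply: lb_le_inf => // _ [c /= Cc <-].
      rewrite lerBlDr -lerBlDl; apply: lb_le_inf => // _ [d /= Cd <-].
      (* The lower of [c] and [d] serves at both points, so its own subadditivity suffices. *)
      rewrite lerBlDl; have [/asboolP cd|/asboolP dc] := totC _ _ Cc Cd.
        apply: le_trans (infS _ d Cd) _; apply: le_trans ((svalP d).1.1 _ _) _.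
        by rewrite lerD2r.
      apply: le_trans (infS _ c Cc) _; apply: le_trans ((svalP c).1.1 _ _) _.
      by rewrite lerD2l.
    rewrite -ler_pdivrMl//; apply: lb_le_inf => // _ [c /= Cc <-].
    rewrite ler_pdivrMl//; apply: le_trans (infS _ c Cc) _.
    exact: (svalP c).1.2.
  have qp x : inf (S x) <= p x.
    by apply: le_trans (infS x c0 Cc0) _; exact: (svalP c0).2.
  exists (exist _ (fun x => inf (S x)) (conj sq qp)) => c Cc.
  by apply/asboolP => x /=; exact: infS.
- exists q; split => // s ss sq'.
  have sp' x : s x <= p x by exact: le_trans (sq' x) (qp x).
  have /asboolP := qmin (exist _ s (conj ss sp')) ltac:(exact/asboolP).
  exact.
Qed.

(* Hahn-Banach: a minimal sublinear functional is additive, since otherwise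
   [sublinear_step] lowers it. *)
Lemma sublinear_linear_minorant (R : realType) (V : lmodType R) (p : V -> R) :
  sublinear p -> exists l : {linear V -> R^o}, forall x, l x <= p x.
Proof.
move=> sp; have [q [sq qp qmin]] := minimal_sublinear sp.
have qD x y : q (x + y) = q x + q y.
  apply/eqP; rewrite eq_le sq.1/=.
  have [r [sr rq rv]] := sublinear_step y sq.
  by have := qmin r sr rq x; have := rv x; lra.
have qN x : q (- x) = - q x.
  by have := qD x (- x); rewrite subrr sublinear0//; lra.
have qZ (t : R) x : q (t *: x) = t * q x.
  have [t0|t0] := leP 0 t; first exact: sublinearZ.
  by rewrite -[t]opprK scaleNr qN sublinearZ ?oppr_ge0 ?ltW// !mulNr.
have lq : linear (q : V -> R^o) by move=> t x y; rewrite qD qZ.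
pose L := GRing.isLinear.Build R V R^o *:%R q lq.
pose l : {linear V -> R^o} := HB.pack q L.
by exists l.
Qed.

(** [sublinear_step] applied to the norm in the direction [y] gives [q (- y) <= - |y|], so a linear
    minorant of [q] is at least |y| at [y]. *)
Lemma norming_functional (R : realType) (Y : normedModType R) (y : Y) :
  exists l : {linear Y -> R^o}, [/\ continuous l, op_norm l <= 1 & l y = `|y|].
Proof.
have sN : sublinear (fun x : Y => `|x|).
  split=> [x z|t x t0]; first exact: ler_normD.
  by rewrite normrZ gtr0_norm.
have [q [sq qN qy]] := sublinear_step y sN.
have [l lq] := sublinear_linear_minorant sq.
have lN x : `|l x| <= `|x|.
  rewrite ler_norml (le_trans (lq x) (qN x)) andbT lerNl -linearN.
  by rewrite (le_trans (lq _))// (le_trans (qN _))// normrN.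
exists l; split.
- apply: bounded_linear_continuous; apply/linear_boundedP.
  near=> r => x; have r1 : 1 <= r by near: r; exact: nbhs_pinfty_ge.
  by apply: le_trans (lN x) _; rewrite ler_peMl.
- apply: ge_sup; first by exists `|l 0|, 0 => //=; rewrite normr0.
  by move=> _ [v /= v1 <-]; exact: le_trans (lN v) v1.
- apply/eqP; rewrite eq_le (le_trans (ler_norm _) (lN y))/=.
  have := lq (- y); have := qy (- y); rewrite addNr normr0 linearN; lra.
Unshelve. all: by end_near. Qed.

(** * Jensen gaps and slopes of convex functions *)

Lemma continuous_linear_le (R : realType) (V W : normedModType R)
    (T : {linear V -> W}) :
  continuous T -> exists2 C : R, 0 <= C & forall v, `|T v| <= C * `|v|.
Proof.
move=> /linear_bounded_continuous/linear_boundedP/pinfty_ex_gt0[C C0 CT].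
by exists C; first exact: ltW.
Qed.

(** The bound [C] makes the real-valued [sup] a true supremum. [T] is a plain homogeneous map so
    that a difference of two derivatives qualifies. *)
Lemma le_op_norm (R : realType) (V W : normedModType R) (T : V -> W) (C : R) :
  (forall (k : R) v, T (k *: v) = k *: T v) -> (forall v, `|T v| <= C * `|v|) ->
  forall v, `|T v| <= op_norm T * `|v|.
Proof.
move=> TZ TC v; have C0 u : `|u| <= 1 -> `|T u| <= `|C|.
  move=> u1; apply: le_trans (TC u) _; apply: le_trans (ler_norm _) _.
  by rewrite normrM normr_id ler_piMr.
have [->|v0] := eqVneq v 0.
  by have := TZ 0 0; rewrite !scale0r => ->; rewrite !normr0 mulr0.
have vp : 0 < `|v| by rewrite normr_gt0.
have -> : `|T v| = `|T (`|v|^-1 *: v)| * `|v|.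
  by rewrite TZ normrZ gtr0_norm ?invr_gt0// mulrAC mulVf ?mul1r// gt_eqF.
rewrite ler_pM2r//; apply: sup_ubound.
  by exists `|C| => _ [u /= u1 <-]; exact: C0.
exists (`|v|^-1 *: v) => //=.
by rewrite normrZ gtr0_norm ?invr_gt0// mulVf// gt_eqF.
Qed.

Lemma dual_ball_le (R : realType) (Y : normedModType R) (l : {linear Y -> R^o}) v :
  continuous l -> op_norm l <= 1 -> `|l v| <= `|v|.
Proof.
move=> /continuous_linear_le[C _ lC] l1.
have := @le_op_norm _ _ _ l C (fun k u => linearZZ l k u) lC v.
by move/le_trans; apply; rewrite ler_piMl.
Qed.

Lemma convex_functionP (R : realType) (X : normedModType R) (D : set X)
    (k : X -> R^o) :
  convex_function (D : set (convex_lmodType X)) k <->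
  forall (s t : R) x y, 0 <= s -> 0 <= t -> s + t = 1 -> D x -> D y ->
    k (s *: x + t *: y) <= s * k x + t * k y.
Proof.
split=> [ck s t x y s0 t0 st Dx Dy|ck t x y /set_mem Dx /set_mem Dy]; last first.
  by apply: ck => //; rewrite ?subr_ge0 ?ge0 ?le1// addrC subrK.
have s1 : s <= 1 by lra.
have := ck (Itv01 s0 s1) x y; rewrite !inE => /(_ Dx Dy).
by have -> : t = 1 - s by lra.
Qed.

Lemma convex_setP (R : realType) (X : normedModType R) (D : set X) :
  convex_set (D : set (convex_lmodType X)) ->
  forall (s t : R) x y, 0 <= s -> 0 <= t -> s + t = 1 -> D x -> D y ->
    D (s *: x + t *: y).
Proof.
move=> cD s t x y s0 t0 st Dx Dy; have s1 : s <= 1 by lra.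
have := cD x y (Itv01 s0 s1); rewrite !inE => /(_ Dx Dy).
by have -> : t = 1 - s by lra.
Qed.

Lemma control_gap (R : realType) (X Y : normedModType R) (C : set X)
    (F : X -> Y) (f : X -> R^o) (s t : R) (x y : X) :
  control_function C F f -> 0 <= s -> 0 <= t -> s + t = 1 -> C x -> C y ->
  `|s *: F x + t *: F y - F (s *: x + t *: y)|
    <= s * f x + t * f y - f (s *: x + t *: y).
Proof.
move=> [_ cF] s0 t0 st Cx Cy.
(* Convexity of [l \o F + f] bounds [- l] of the gap, hence a functional norming the opposite of the
   gap. *)
have [l [lc l1 lv]] :=
  norming_functional (- (s *: F x + t *: F y - F (s *: x + t *: y))).
have /convex_functionP/(_ s t x y s0 t0 st Cx Cy) := cF l lc l1.
move: lv; rewrite normrN => <-; rewrite !(linearN, linearD, linearZ)/=.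
by rewrite /GRing.scale/=; lra.
Qed.

(** Prolong the segment from [a] to [b] by the length [d] beyond [b]: [b] is then a convex
    combination of [a] and a point where [k] exceeds [k b] by at most [M]. *)
Lemma convex_slope (R : realType) (Y : normedModType R) (B : set Y)
    (k : Y -> R^o) (b : Y) (d M : R) :
  convex_function (B : set (convex_lmodType Y)) k -> 0 < d ->
  (forall b', `|b' - b| <= d -> B b' /\ k b' - k b <= M) ->
  forall a, B a -> k b - M / d * `|a - b| <= k a.
Proof.
move=> /convex_functionP ck d0 kM a Ba.
have [->|ab] := eqVneq a b; first by rewrite subrr normr0 mulr0 subr0.
have e0 : 0 < `|a - b| by rewrite normr_gt0 subr_eq0.
set e := `|a - b| in e0 *; have ed0 : e + d != 0 by lra.
have [|Bb' kb'] := kM (b - (d / e) *: (a - b)).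
  rewrite addrAC subrr add0r normrN normrZ gtr0_norm ?divr_gt0//.
  by rewrite -/e divfK// gt_eqF.
have ed1 : e / (e + d) + d / (e + d) = 1 by rewrite -mulrDl divff.
have H := ck _ _ _ _ (divr_ge0 (ltW e0) (addr_ge0 (ltW e0) (ltW d0)))
  (divr_ge0 (ltW d0) (addr_ge0 (ltW e0) (ltW d0))) ed1 Bb' Ba.
have E : e / (e + d) *: (b - (d / e) *: (a - b)) + d / (e + d) *: a = b.
  rewrite scalerBr scalerA (_ : e / (e + d) * (d / e) = d / (e + d)); last first.
    by field; rewrite ed0 gt_eqF.
  rewrite scalerBr opprB addrA subrK -scalerDl ed1 scale1r//.
move: H; rewrite E; set k' := k (b - _) in kb' *.
rewrite -(ler_pM2r (addr_gt0 e0 d0)).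
rewrite (_ : (e / _ * k' + d / _ * k a) * _ = e * k' + d * k a); last by field.
move=> H.
rewrite lerBlDr -(ler_pM2r d0) mulrDl mulrAC divfK ?gt_eqF//.
have : e * (k' - k b) <= e * M by rewrite ler_pM2l.
by nra.
Qed.

Lemma continuous_at_open (R : realType) (X Y : normedModType R) (A : set X)
    (F : X -> Y) (x : X) :
  open A -> {within A, continuous F} -> A x -> {for x, continuous F}.
Proof.
by move=> oA; rewrite continuous_open_subspace// => cF Ax; apply: cF; rewrite inE.
Qed.

Lemma locally_close (R : realType) (X Y : normedModType R) (A : set X)
    (F : X -> Y) (f : X -> R^o) (x0 : X) :
  open A -> {within A, continuous F} -> {within A, continuous f} -> A x0 ->
  exists2 d : R, 0 < d & forall x, `|x - x0| <= d ->
    [/\ A x, `|F x - F x0| <= 1 & `|f x - f x0| <= 1].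
Proof.
move=> oA cF cf Ax0.
have /nbhs_normP[e /= e0 he] : \forall x \near x0,
    [/\ A x, `|F x - F x0| <= 1 & `|f x - f x0| <= 1].
  near=> x; split.
  - by near: x; exact: open_nbhs_nbhs.
  - rewrite distrC; near: x; have /cvgrPdist_le := continuous_at_open oA cF Ax0.
    by apply; lra.
  - rewrite distrC; near: x; have /cvgrPdist_le := continuous_at_open oA cf Ax0.
    by apply; lra.
exists (e / 2); first by rewrite divr_gt0.
move=> x xe; apply: he => /=; rewrite distrC.
by apply: le_lt_trans xe _; lra.
Unshelve. all: by end_near. Qed.

(** Near a fixed [x0] the convex functions [l \o F + f] rise by at most 2, uniformly in [l], so
    [convex_slope] gives them a common minorant of linear growth; using both [l] and [- l] yields
    the absolute value. *)
Lemma control_growth (R : realType) (X Y : normedModType R) (A : set X)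
    (F : X -> Y) (f : X -> R^o) :
  open A -> {within A, continuous F} -> control_function A F f ->
  exists K C : R, [/\ 0 <= K, 0 <= C &
    forall (l : {linear Y -> R^o}) x, continuous l -> op_norm l <= 1 -> A x ->
      `|l (F x)| <= f x + K + C * `|x|].
Proof.
move=> oA cF [cf cF1].
have [->|/set0P[x0 Ax0]] := eqVneq A set0; first by exists 0, 0.
have [d d0 hd] := locally_close oA cF cf Ax0.
exists (`|F x0| + `|f x0| + 2 / d * `|x0|), (2 / d).
have d2 : 0 <= 2 / d by rewrite divr_ge0// ltW.
split=> // [|l x lc l1 Ax]; first by rewrite !addr_ge0// mulr_ge0.
have half (m : {linear Y -> R^o}) : continuous m -> op_norm m <= 1 ->
    - m (F x) <= f x + (`|F x0| + `|f x0| + 2 / d * `|x0|) + 2 / d * `|x|.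
  move=> mc m1.
  have := @convex_slope _ _ _ _ x0 d 2 (cF1 m mc m1) d0 _ x Ax.
  have h x' : `|x' - x0| <= d ->
      A x' /\ m (F x') + f x' - (m (F x0) + f x0) <= 2.
    move=> /hd[Ax' Fx' fx']; split => //.
    have := dual_ball_le (F x' - F x0) mc m1; rewrite linearB.
    have := ler_norm (m (F x') - m (F x0)); have := ler_norm (f x' - f x0).
    lra.
  move=> /(_ h) H.
  have := dual_ball_le (F x0) mc m1; have := ler_norm (- m (F x0)).
  rewrite normrN; have := ler_norm (- f x0); rewrite normrN.
  have : 2 / d * `|x - x0| <= 2 / d * (`|x| + `|x0|).
    by rewrite ler_wpM2l// ler_normB.
  rewrite mulrDr; lra.
rewrite ler_norml lerNl half//=.
have [m [mc m1 mE]] : exists m : {linear Y -> R^o},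
    [/\ continuous m, op_norm m <= 1 & forall y, m y = - l y].
  have mlin : linear (fun y => - l y : R^o).
    by move=> t u v; rewrite linearP opprD scalerN.
  pose m : {linear Y -> R^o} := HB.pack (fun y => - l y : R^o)
    (GRing.isLinear.Build R Y R^o *:%R _ mlin).
  exists m; split=> //.
    by move=> y; exact: continuousN (lc y).
  rewrite (_ : op_norm m = op_norm l)//; rewrite /op_norm; congr sup.
  by apply/seteqP; split=> _ [v v1 <-]; exists v; rewrite //= normrN.
by have := half m mc m1; rewrite mE opprK.
Qed.

(** * Convex functions on the line with prescribed slopes *)

(** [psi] is the sum of the hinges [L n * max (s - n) 0], and the subgradient [sigma s] adds the
    [L n] with [n <= s]. In the last item, a hinge at [m] between [s] and [r] adds [L m * (r - m)]
    above the tangent at [s]. *)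
Lemma hinge_sum (R : realType) (L : nat -> R) :
  (forall n, 0 <= L n) ->
  exists psi sigma : R -> R,
  [/\ forall s r, psi s + sigma s * (r - s) <= psi r,
      {homo sigma : s r / s <= r},
      forall s, 0 <= sigma s,
      forall s, 0 <= s -> L (Num.truncn s) <= sigma s
    & forall s (m : nat) r, s < m%:R -> m%:R <= r ->
        psi s + sigma s * (r - s) + L m * (r - m%:R) <= psi r].
Proof.
move=> L0.
pose psi_ N (s : R) := \sum_(n < N) L n * Num.max (s - n%:R) 0.
pose sigma_ N (s : R) := \sum_(n < N) (if n%:R <= s then L n else 0).
pose psi s := psi_ (Num.truncn s).+1 s.
pose sigma s := sigma_ (Num.truncn s).+1 s.
(* Hinges beyond [s] vanish, so every truncation past [s] gives the same values, and two points can
   share one [N]. *)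
have stable N (s : R) : s < N%:R -> psi s = psi_ N s /\ sigma s = sigma_ N s.
  move=> sN.
  have ext (a : nat -> R) M M' : (M <= M')%N ->
      (forall n : nat, (M <= n)%N -> a n = 0) ->
      \sum_(n < M') a n = \sum_(n < M) a n.
    move=> MM a0; rewrite (big_ord_widen _ a MM) [RHS]big_mkcond/=.
    apply: eq_bigr => i _.
    by case: ifPn => //; rewrite -leqNgt => /a0.
  have big M n : s < M%:R -> (M <= n)%N ->
      Num.max (s - n%:R) 0 = 0 /\ (n%:R <= s) = false.
    rewrite -(ler_nat R) => sM Mn; split; last by apply/negbTE; rewrite -ltNge; lra.
    by apply/max_idPr; lra.
  have tS := truncnS_gt s.
  pose a1 (n : nat) := L n * Num.max (s - n%:R) 0.
  pose a2 (n : nat) := if n%:R <= s then L n else 0.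
  have [le|/ltnW le] := leqP (Num.truncn s).+1 N; split.
  - by apply/esym/(ext a1 _ _ le) => n; rewrite /a1
      => /(big _ _ tS)[-> _]; rewrite mulr0.
  - by apply/esym/(ext a2 _ _ le) => n; rewrite /a2
      => /(big _ _ tS)[_ ->].
  - by apply/(ext a1 _ _ le) => n; rewrite /a1
      => /(big _ _ sN)[-> _]; rewrite mulr0.
  - by apply/(ext a2 _ _ le) => n; rewrite /a2
      => /(big _ _ sN)[_ ->].
have term n (s r : R) :
    L n * Num.max (s - n%:R) 0 + (if n%:R <= s then L n else 0) * (r - s)
    <= L n * Num.max (r - n%:R) 0.
  have := L0 n; set Ln := L n; set a := n%:R => Ln0.
  case: (leP a s) => ns; case: (leP (s - a) 0) => sa; case: (leP (r - a) 0) => ra;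
    do ?[lra | nra].
have common (s r : R) : exists2 N : nat, s < N%:R & r < N%:R.
  exists (maxn (Num.truncn s).+1 (Num.truncn r).+1).
    by rewrite (lt_le_trans (truncnS_gt s))// ler_nat leq_maxl.
  by rewrite (lt_le_trans (truncnS_gt r))// ler_nat leq_maxr.
exists psi, sigma; split.
- move=> s r; have [N sN rN] := common s r.
  have [-> ->] := stable _ _ sN; have [-> _] := stable _ _ rN.
  rewrite /psi_ /sigma_ mulr_suml -big_split.
  by apply: ler_sum => n _; exact: term.
- move=> s r sr; have [N sN rN] := common s r.
  have [_ ->] := stable _ _ sN; have [_ ->] := stable _ _ rN.
  apply: ler_sum => n _; have := L0 n.
  by case: (leP n%:R s) => // [ns|_]; [rewrite (le_trans ns sr)|case: ifP].
- by move=> s; apply: sumr_ge0 => n _; case: ifP.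
- move=> s s0; rewrite /sigma /sigma_ big_ord_recr/= truncn_le s0.
  by rewrite lerDr sumr_ge0// => n _; case: ifP.
- move=> s m r sm mr; have [N sN rN] := common s r.
  have [-> ->] := stable _ _ sN; have [-> _] := stable _ _ rN.
  have mN : (m < N)%N by rewrite -(ltr_nat R) (le_lt_trans mr).
  rewrite /psi_ /sigma_ mulr_suml -big_split/=.
  rewrite (bigD1 (Ordinal mN))//= [leRHS](bigD1 (Ordinal mN))//=.
  rewrite (addrAC (_ + _)); apply: lerD; last by apply: ler_sum => n _; exact: term.
  rewrite (leNgt m%:R s) sm mul0r addr0.
  have -> : Num.max (s - m%:R) 0 = 0 by apply/max_idPr; lra.
  have -> : Num.max (r - m%:R) 0 = r - m%:R by apply/max_idPl; lra.
  by rewrite mulr0 add0r.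
Qed.

Lemma subgradient_continuous (R : realType) (psi sigma : R -> R) :
  (forall s r, psi s + sigma s * (r - s) <= psi r) ->
  {homo sigma : s r / s <= r} -> (forall s, 0 <= sigma s) ->
  continuous (psi : R^o -> R^o).
Proof.
move=> psiS sigmaM sigma0 /= s; apply/(@cvgrPdist_le R R^o) => e e0.
(* By monotonicity [sigma (s + 1)] bounds the slopes at all points within 1 of [s]; adding 1 makes
   the divisor positive. *)
have M0 : 0 < sigma (s + 1) + 1 by have := sigma0 (s + 1); lra.
near=> r.
have rs : `|s - r| <= 1 by near: r; exact: cvgr_dist_le.
have rsM : `|s - r| <= e / (sigma (s + 1) + 1).
  by near: r; apply: cvgr_dist_le => //; exact: divr_gt0.
have /= := psiS s r; have /= := psiS r s.
have s1 : sigma s <= sigma (s + 1) by apply: sigmaM; rewrite lerDl.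
have r1 : sigma r <= sigma (s + 1).
  by apply: sigmaM; move: rs; rewrite distrC => /ler_normlW; rewrite lerBlDl.
have le u : sigma u <= sigma (s + 1) -> sigma u * `|s - r| <= e.
  move=> u1; move: rsM; rewrite ler_pdivlMr// => rsM.
  apply: le_trans rsM; rewrite mulrC ler_wpM2l//; lra.
have h1 := le _ s1; have h2 := le _ r1.
have a1 : sigma s * (s - r) <= sigma s * `|s - r| by rewrite ler_wpM2l// ler_norm.
have a2 : sigma r * (r - s) <= sigma r * `|s - r|.
  by rewrite ler_wpM2l// distrC ler_norm.
rewrite ler_norml; lra.
Unshelve. all: by end_near. Qed.

(** * Composition under a bound on slopes *)

Lemma continuous_within_comp (R : realType) (X Y Z : normedModType R)
    (A : set X) (B : set Y) (F : X -> Y) (G : Y -> Z) :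
  open A -> open B -> set_fun A B F -> {within A, continuous F} ->
  {within B, continuous G} -> {within A, continuous (G \o F)}.
Proof.
move=> oA oB FAB cF cG; rewrite continuous_open_subspace// => x /set_mem Ax.
apply: continuous_comp; first exact: continuous_at_open cF Ax.
exact: continuous_at_open cG (FAB _ Ax).
Qed.

(** This is the minorant at [b] from the overview, with one [L] for the whole dual unit ball. *)
Definition slope_bound (R : realType) (Y Z : normedModType R) (B : set Y)
    (G : Y -> Z) (g : Y -> R^o) (L : R) (b : Y) : Prop :=
  forall l : {linear Z -> R^o}, continuous l -> op_norm l <= 1 ->
    forall a, B a -> l (G b) + g b - L * `|a - b| <= l (G a) + g a.

Lemma le_slope_bound (R : realType) (Y Z : normedModType R) (B : set Y)
    (G : Y -> Z) (g : Y -> R^o) (L L' : R) (b : Y) :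
  L <= L' -> slope_bound B G g L b -> slope_bound B G g L' b.
Proof.
move=> LL' GL l lc l1 a Ba; apply: le_trans (GL l lc l1 a Ba).
by rewrite lerD2l lerN2 ler_wpM2r.
Qed.

Lemma delta_convex_comp_slope (R : realType) (X Y Z : normedModType R)
    (A : set X) (B : set Y) (F : X -> Y) (G : Y -> Z) (g : Y -> R^o) :
  open A -> convex_set (A : set (convex_lmodType X)) ->
  open B -> convex_set (B : set (convex_lmodType Y)) -> set_fun A B F ->
  delta_convex A F -> {within B, continuous G} -> control_function B G g ->
  (forall n : nat, exists L : R, forall b, (F @` A) b -> `|b| <= n%:R ->
    slope_bound B G g L b) ->
  delta_convex A (G \o F).
Proof.
move=> oA cA oB cB FAB [cF [f Ff]] cG Gg /choice[L0 L0P].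
split; first exact: continuous_within_comp cF cG.
have [K [C [K0 C0 growF]]] := control_growth oA cF Ff.
(* The added terms are convex, so the gap of [p] is at least that of [f]. *)
pose p x := f x + K + C * `|x|.
have Fp x : A x -> `|F x| <= p x.
  move=> Ax; have [l [lc l1 <-]] := norming_functional (F x).
  exact: le_trans (ler_norm _) (growF l x lc l1 Ax).
(* The shift is due to |F w| <= p w < truncn (p w) + 1. *)
pose L n := Num.max (L0 n.+1) 0.
have [n|psi [sigma [psiS sigmaM sigma0 sigmaL _]]] := @hinge_sum R L.
  by rewrite le_max lexx orbT.
exists (fun x => g (F x) + psi (p x)); split.
  have cgF := continuous_within_comp oA oB FAB cF Gg.1.
  rewrite continuous_open_subspace// => x /set_mem Ax.
  apply: continuousD; first exact: (continuous_at_open oA cgF Ax).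
  apply: (@continuous_comp _ _ _ p psi); last exact: subgradient_continuous.
  apply: continuousD.
    apply: continuousD; last exact: cst_continuous.
    exact: (continuous_at_open oA Ff.1 Ax).
  apply: (@continuousM _ _ (cst C) (fun y : X => `|y|)).
    exact: cst_continuous.
  exact: norm_continuous.
move=> l lc l1; apply/convex_functionP => s t x y s0 t0 st Ax Ay /=.
set w := s *: x + t *: y; have Aw : A w by exact: (convex_setP cA).
have := control_gap Ff s0 t0 st Ax Ay; rewrite -/w.
set a := s *: F x + t *: F y => gapF.
have Ba : B a by apply: (convex_setP cB) => //; exact: FAB.
have Lw : slope_bound B G g (sigma (p w)) (F w).
  have pw0 : 0 <= p w by exact: le_trans (Fp _ Aw).
  apply: le_slope_bound (L0P (Num.truncn (p w)).+1 _ _ _).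
  - by apply: le_trans (sigmaL _ pw0); rewrite /L le_max lexx.
  - by exists w.
  - by rewrite (le_trans (Fp _ Aw))// ltW// truncnS_gt.
have {Lw} kw := Lw l lc l1 a Ba.
have /convex_functionP/(_ s t _ _ s0 t0 st (FAB _ Ax) (FAB _ Ay)) := Gg.2 l lc l1.
rewrite -/a => ka.
have gapp : s * f x + t * f y - f w <= s * p x + t * p y - p w.
  have : C * `|w| <= C * (s * `|x| + t * `|y|).
    rewrite ler_wpM2l// (le_trans (ler_normD _ _))// !normrZ.
    by rewrite (ger0_norm s0) (ger0_norm t0).
  have := congr1 ( *%R^~ K) st; rewrite /p mulrDl mul1r; lra.
have sg : sigma (p w) * `|a - F w| <= sigma (p w) * (s * p x + t * p y - p w).
  by rewrite ler_wpM2l// (le_trans gapF).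
(* The weighted subgradient inequalities at [p w] bound the gap of [psi \o p] below by [sigma (p w)]
   times the gap of [p], which pays for the slope loss. *)
have psix : s * (psi (p w) + sigma (p w) * (p x - p w)) <= s * psi (p x).
  by rewrite ler_wpM2l.
have psiy : t * (psi (p w) + sigma (p w) * (p y - p w)) <= t * psi (p y).
  by rewrite ler_wpM2l.
have Es : t = 1 - s by lra.
move: ka kw sg psix psiy; rewrite Es.
set pw := p w; set sw := sigma pw; lra.
Qed.

(** * Slope bounds in cases (a) and (b) *)

(** Continuity bounds the oscillation of [l \o G + g] near [b0] uniformly in [l]. The form with [L]
    near infinity is the one needed for near coverings of compact sets. *)
Lemma slope_bound_near (R : realType) (Y Z : normedModType R) (B : set Y)
    (G : Y -> Z) (g : Y -> R^o) (b0 : Y) :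
  open B -> {within B, continuous G} -> control_function B G g -> B b0 ->
  \forall b \near b0 & L \near +oo, slope_bound B G g L b.
Proof.
move=> oB cG [cg cGg] Bb0; have [d d0 hd] := locally_close oB cG cg Bb0.
have d2 : 0 < d / 2 by rewrite divr_gt0.
near=> b L.
(* [G] and [g] each oscillate by at most 2 on the ball of radius [d] about [b0], which contains the
   ball of radius [d / 2] about [b]. *)
have dL : 4 / (d / 2) <= L by near: L; apply: nbhs_pinfty_ge; rewrite num_real.
have bb0 : `|b - b0| <= d / 2.
  by rewrite distrC; near: b; apply: cvgr_dist_le.
move=> l lc l1 a Ba.
have slope : forall b', `|b' - b| <= d / 2 ->
    B b' /\ l (G b') + g b' - (l (G b) + g b) <= 4.
  move=> b' b'b.
  have /hd[_ Gb gb] : `|b - b0| <= d by rewrite (le_trans bb0)//; lra.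
  have /hd[Bb' Gb' gb'] : `|b' - b0| <= d.
    by have := ler_distD b b' b0; lra.
  split=> //; have := dual_ball_le (G b' - G b) lc l1; rewrite linearB.
  have := ler_norm (l (G b') - l (G b)); have := ler_norm (g b' - g b).
  have := ler_distD (G b0) (G b') (G b); have := ler_distD (g b0) (g b') (g b).
  rewrite (distrC (G b0)) (distrC (g b0)); lra.
apply: le_trans (convex_slope (cGg l lc l1) d2 slope Ba).
rewrite lerD2l lerN2 ler_wpM2r.
Unshelve. all: by end_near. Qed.

Lemma slope_bound_compact (R : realType) (Y Z : normedModType R) (B K : set Y)
    (G : Y -> Z) (g : Y -> R^o) :
  open B -> {within B, continuous G} -> control_function B G g ->
  compact K -> K `<=` B -> exists L, forall b, K b -> slope_bound B G g L b.
Proof.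
move=> oB cG Gg /compact_near_coveringP cK KB.
have := cK R +oo (fun L b => slope_bound B G g L b) _ _.
case=> [x Kx|M [_ hM]]; first by apply: slope_bound_near => //; exact: KB.
by exists (M + 1); apply: hM; rewrite ltrDl.
Qed.

(** [control_growth] for [G] turns a bound on [g] into a bound on every [l \o G + g] over the ball
    of radius [n + 1], and [convex_slope] applies with radius 1. *)
Lemma slope_bound_bounded (R : realType) (Y Z : normedModType R)
    (G : Y -> Z) (g : Y -> R^o) (n : nat) :
  {within [set: Y], continuous G} -> control_function [set: Y] G g ->
  bounded_on_bounded_sets g ->
  exists L, forall b, `|b| <= n%:R -> slope_bound [set: Y] G g L b.
Proof.
move=> cG Gg bg; have [K [C [K0 C0 hG]]] := control_growth openT cG Gg.
have [|M M0 hM] := pinfty_ex_gt0 (bg [set y | `|y| <= n%:R + 1] _).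
  by exists (n%:R + 1); split=> // x nx y /= /le_trans; apply; exact: ltW.
have bound y (l : {linear Z -> R^o}) : continuous l -> op_norm l <= 1 ->
    `|y| <= n%:R + 1 -> `|l (G y) + g y| <= M + M + K + C * (n%:R + 1).
  move=> lc l1 y1; apply: le_trans (ler_normD _ _) _.
  have := hG l y lc l1 Logic.I; have /= gM := hM y y1.
  have := ler_norm (g y); have : C * `|y| <= C * (n%:R + 1) by rewrite ler_wpM2l.
  by lra.
exists ((M + M + K + C * (n%:R + 1)) *+ 2 / 1) => b bn l lc l1 a _.
apply: convex_slope (Gg.2 l lc l1) ltr01 _ a Logic.I => b' bb'; split=> //.
have b1 : `|b| <= n%:R + 1 by lra.
have b'1 : `|b'| <= n%:R + 1 by have := ler_normD (b' - b) b; rewrite subrK; lra.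
have := bound b l lc l1 b1; have := bound b' l lc l1 b'1.
have := ler_norm (l (G b') + g b'); have := ler_norm (- (l (G b) + g b)).
by rewrite normrN mulr2n; lra.
Qed.

Lemma finite_dimensional_free (R : realType) (Y : lmodType R) :
  finite_dimensional Y -> exists (n : nat) (e : 'I_n -> Y),
    (forall y, exists c : 'I_n -> R, y = \sum_(i < n) c i *: e i) /\
    (forall c : 'I_n -> R, \sum_(i < n) c i *: e i = 0 -> forall i, c i = 0).
Proof.
case=> n; elim: n => [|n IHn] [e espan].
  by exists 0, e; split=> // c _ [].
have [free|/existsNP[c /not_implyP[ec /existsNP[j /eqP cj]]]] :=
  pselect (forall c : 'I_n.+1 -> R, \sum_i c i *: e i = 0 -> forall i, c i = 0).
  by exists n.+1, e.
apply: IHn; exists (fun i => e (lift j i)) => y.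
(* The relation [ec] is solved for [e j], which is then eliminated from the expansion of [y]. *)
have [d ->] := espan y; exists (fun i => d (lift j i) - d j / c j * c (lift j i)).
have := congr1 ( *:%R (d j / c j)) ec; rewrite scaler0 scaler_sumr => ec0.
rewrite -[LHS]subr0 -[X in _ - X]ec0 -sumrB.
rewrite (bigD1_ord j)//= scalerA divfK// subrr add0r.
by apply: eq_bigr => i _; rewrite scalerA scalerBl.
Qed.

(** The injective coordinate map [T] is bounded below by some [m > 0] on the compact unit sphere, so
    the ball of radius [r] lies in the image of the coordinate ball of radius [r / m]. *)
Lemma finite_dimensional_bounded_compact (R : realType) (Y : normedModType R)
    (r : R) :
  finite_dimensional Y ->
  exists2 K : set Y, compact K & forall y, `|y| <= r -> K y.
Proof.
move=> /finite_dimensional_free[n [e [espan efree]]].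
pose T (v : 'rV[R]_n) : Y := \sum_(i < n) v 0 i *: e i.
have TZ k v : T (k *: v) = k *: T v.
  by rewrite scaler_sumr; apply: eq_bigr => i _; rewrite mxE scalerA.
have Tc : continuous T.
  have addc : continuous (fun z : Y * Y => z.1 + z.2) by exact: add_continuous.
  apply: (@continuous_big Y 'I_n +%R 0 xpredT addc _ _
    (fun i (v : 'rV[R]_n) => v 0 i *: e i)) => i _ v.
  apply: cvgZr_tmp; first exact: (nbhs_filter v).
  exact: (@coord_continuous R 1 n 0 i v).
pose S := [set v : 'rV[R]_n | `|v| = 1].
have cS : compact S.
  apply: bounded_closed_compact.
    by exists 1; split=> // x x1 v /= ->; exact: ltW.
  apply: (@closed_comp _ _ (fun v : 'rV[R]_n => `|v|) [set 1]).
    by move=> v _; exact: norm_continuous.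
  exact: closed_eq.
have [m m0 hm] : exists2 m : R, 0 < m & forall v, m * `|v| <= `|T v|.
  have scale m : (forall u, S u -> m <= `|T u|) -> forall v, m * `|v| <= `|T v|.
    move=> hm v; have [->|v0] := eqVneq v 0; first by rewrite normr0 mulr0.
    have vp : 0 < `|v| by rewrite normr_gt0.
    have := hm (`|v|^-1 *: v); rewrite TZ /S/= !normrZ gtr0_norm ?invr_gt0//.
    rewrite mulVf ?gt_eqF// => /(_ erefl).
    by rewrite ler_pdivlMl// mulrC.
  (* The sphere is empty when [n = 0]. *)
  have [S0|/set0P S0] := eqVneq S set0.
    by exists 1 => //; apply: scale => u; rewrite S0.
  have [|u /set_mem Su umin] := @compact_EVT_min _ R (fun v => `|T v|) S S0 cS.
    apply: continuous_subspaceT => v; apply: continuous_comp; first exact: Tc.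
    exact: norm_continuous.
  exists `|T u|; last by apply: scale => v Sv; apply: umin; rewrite inE.
  rewrite normr_gt0; apply/eqP => /efree u0.
  have : u = 0 by apply/rowP => i; rewrite u0 mxE.
  by move=> uz; move: Su; rewrite /S/= uz normr0 => /eqP; rewrite eq_sym oner_eq0.
exists (T @` [set v | `|v| <= r / m]).
  apply: continuous_compact; first exact: continuous_subspaceT.
  apply: bounded_closed_compact.
    exists (r / m); rewrite num_real; split=> // x x1 v /= /le_trans.
    by apply; exact: ltW.
  apply: (@closed_comp _ _ (fun v : 'rV[R]_n => `|v|) [set x | x <= r / m]).
    by move=> v _; exact: norm_continuous.
  exact: closed_le.
move=> y yr; have [c yc] := espan y; exists (\row_i c i).
  rewrite /= ler_pdivlMr// mulrC (le_trans (hm _))// /T.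
  under eq_bigr do rewrite mxE.
  by rewrite -yc.
by rewrite yc; apply: eq_bigr => i _; rewrite mxE.
Qed.

(** * Norms with modulus of convexity of power type 2 *)

Section EquivalentNorm.
Variables (R : realType) (Y : normedModType R) (N : Y -> R).
Hypothesis eqN : equivalent_norm N.

Lemma equivalent_normZ (k : R) y : N (k *: y) = `|k| * N y.
Proof. by case: eqN. Qed.

Lemma equivalent_normD x y : N (x + y) <= N x + N y.
Proof. by case: eqN. Qed.

Lemma equivalent_norm_ge0 y : 0 <= N y.
Proof.
have [_ _ _ [c [C [c0 C0 /(_ y)[cN _]]]]] := eqN.
by apply: le_trans cN; rewrite mulr_ge0// ltW.
Qed.

Lemma equivalent_normN y : N (- y) = N y.
Proof. by rewrite -scaleN1r equivalent_normZ normrN normr1 mul1r. Qed.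

Lemma equivalent_normB x y : N (x - y) = N (y - x).
Proof. by rewrite -equivalent_normN opprB. Qed.

Lemma equivalent_norm_dist x y : N x - N y <= N (x - y).
Proof. by have := equivalent_normD (x - y) y; rewrite subrK; lra. Qed.

Lemma equivalent_norm_continuous : continuous (N : Y -> R^o).
Proof.
have [_ _ _ [c [C [c0 C0 NC]]]] := eqN.
move=> x; apply/cvgrPdist_le => e e0; near=> y.
have xy : `|x - y| <= e / C.
  by near: y; apply: cvgr_dist_le; rewrite ?divr_gt0.
have : N (x - y) <= e.
  by rewrite (le_trans (NC _).2)// mulrC -ler_pdivlMr.
have := equivalent_norm_dist x y; have := equivalent_norm_dist y x.
rewrite (equivalent_normB y x) ler_norml; lra.
Unshelve. all: by end_near. Qed.

Lemma sqr_norm_convex (s t : R) x y :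
  0 <= s -> 0 <= t -> s + t = 1 ->
  N (s *: x + t *: y) ^+ 2 <= s * N x ^+ 2 + t * N y ^+ 2.
Proof.
move=> s0 t0 st; have N0 := equivalent_norm_ge0.
have h : N (s *: x + t *: y) <= s * N x + t * N y.
  by rewrite (le_trans (equivalent_normD _ _))// !equivalent_normZ !ger0_norm.
apply: (@le_trans _ _ ((s * N x + t * N y) ^+ 2)).
  by rewrite ler_pXn2r ?nnegrE// addr_ge0// mulr_ge0.
rewrite -subr_ge0 [leRHS](_ : _ = s * t * (N x - N y) ^+ 2); last first.
  by (have -> : t = 1 - s by lra); ring.
by rewrite mulr_ge0 ?sqr_ge0// mulr_ge0.
Qed.

(** The modulus inequality is rescaled from the unit ball to radius [M], with
    [eps = N (u - v) / M]. *)
Lemma modulus_midpoint (a M : R) u v :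
  (forall eps : R, 0 < eps -> eps <= 2 ->
      ((a * eps ^+ 2)%:E <= modulus_of_convexity N eps)%E) ->
  0 < M -> N u <= M -> N v <= M ->
  N (2^-1 *: (u + v)) <= M - a * N (u - v) ^+ 2 / M.
Proof.
move=> ha M0 uM vM.
have [e0|] := leP (N (u - v)) 0.
  have -> : N (u - v) = 0 by apply/eqP; rewrite eq_le e0 equivalent_norm_ge0.
  rewrite expr0n mulr0 mul0r subr0 equivalent_normZ ger0_norm ?invr_ge0//.
  have := equivalent_normD u v; lra.
move=> e0; pose eps := N (u - v) / M.
have eps0 : 0 < eps by rewrite divr_gt0.
have eps2 : eps <= 2.
  rewrite ler_pdivrMr//; have := equivalent_normD u (- v).
  rewrite equivalent_normN; lra.
have Minv v' : N v' <= M -> N (M^-1 *: v') <= 1.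
  by rewrite equivalent_normZ ger0_norm ?invr_ge0 ?(ltW M0)// ler_pdivrMl// mulr1.
have h : N (M^-1 *: u - M^-1 *: v) = eps.
  by rewrite -scalerBr equivalent_normZ ger0_norm ?invr_ge0 ?(ltW M0)// mulrC.
have : ((a * eps ^+ 2)%:E <= (1 - N (2^-1 *: (M^-1 *: u + M^-1 *: v)))%:E)%E.
  move/ereal_infP: (ha eps eps0 eps2); apply.
  exists (M^-1 *: u, M^-1 *: v) => //=; split; [exact: Minv|exact: Minv|].
  by rewrite h.
rewrite -scalerDr !scalerA [2^-1 * _]mulrC -scalerA equivalent_normZ.
rewrite ger0_norm ?invr_ge0 ?(ltW M0)// lee_fin => H.
have {}H : M * (a * eps ^+ 2) <= M * (1 - M^-1 * N (2^-1 *: (u + v))).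
  by rewrite ler_pM2l.
rewrite [leRHS](_ : _ = M - M * (a * eps ^+ 2)); last first.
  by rewrite /eps; field; rewrite gt_eqF.
move: H; rewrite [X in _ <= X -> _](_ : _ = M - N (2^-1 *: (u + v))); first lra.
by field; rewrite gt_eqF.
Qed.

Lemma sqr_norm_midpoint :
  modulus_power_type2 N ->
  exists2 k : R, 0 < k & forall x y,
    N (2^-1 *: (x + y)) ^+ 2 <= (N x ^+ 2 + N y ^+ 2) / 2 - k * N (x - y) ^+ 2.
Proof.
move=> [a a0 ha]; have N0 := equivalent_norm_ge0.
(* The two entries serve the two cases below: norms of [x] and [y] far apart compared with [e], or
   close. *)
pose k : R := Num.min 64^-1 (a / 8).
have k0 : 0 < k by rewrite lt_min; apply/andP; split; lra.
exists k => //; suff main x y : N y <= N x ->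
    N (2^-1 *: (x + y)) ^+ 2 <= (N x ^+ 2 + N y ^+ 2) / 2 - k * N (x - y) ^+ 2.
  move=> x y; have [/main//|/ltW/main] := leP (N y) (N x).
  by rewrite addrC equivalent_normB [_ ^+ 2 + _]addrC.
move=> yx; set m := N x in yx *; set n := N y in yx *; set e := N (x - y).
have [m0|] := leP m 0.
  have xy0 : N x = 0 /\ N y = 0 by have := N0 x; have := N0 y; rewrite -/m -/n; lra.
  have e0 : e = 0.
    have := N0 (x - y); have := equivalent_normD x (- y).
    by rewrite equivalent_normN /e; lra.
  have := equivalent_normD x y; have := N0 (2^-1 *: (x + y)).
  rewrite equivalent_normZ ger0_norm ?invr_ge0// e0 /m /n xy0.1 xy0.2 => h1 h2.
  have -> : N (x + y) = 0 by lra.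
  by rewrite mulr0 !expr0n/= mulr0 addr0 mul0r subr0.
move=> m0; have n0 : 0 <= n := N0 y; have e0 : 0 <= e := N0 _.
have emn : e <= m + n.
  by rewrite /e (le_trans (equivalent_normD _ _))// equivalent_normN.
have k64 : k <= 64^-1 by rewrite ge_min lexx.
have k8 : k <= a / 8 by rewrite ge_min lexx orbT.
set P := N _; have P0 : 0 <= P := N0 _.
have Pmn : P <= (m + n) / 2.
  rewrite /P equivalent_normZ ger0_norm ?invr_ge0//.
  by have := equivalent_normD x y; rewrite -/m -/n; lra.
have ke c : k <= c -> k * e ^+ 2 <= c * e ^+ 2.
  by move=> kc; rewrite ler_wpM2r// sqr_ge0.
(* In the far case the scalar gap [(m - n)^2 / 4] is already at least [e^2 / 64]. *)
have [far|near] := leP (e / 4) (m - n).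
  have := ke _ k64.
  have : P ^+ 2 <= ((m + n) / 2) ^+ 2.
    by rewrite ler_pXn2r ?nnegrE// divr_ge0// addr_ge0// ltW.
  have : (e / 4) ^+ 2 <= (m - n) ^+ 2.
    by rewrite ler_pXn2r ?nnegrE// ?divr_ge0// subr_ge0.
  by nra.
have n0' : m / 2 < n by lra.
have np : 0 < n by lra.
(* Rescaling [y] to the norm of [x] moves it by less than [e / 4], so the modulus applies to [x] and
   [z] at distance at least [3 e / 4]. *)
pose z := (m / n) *: y.
have Nz : N z = m.
  by rewrite equivalent_normZ ger0_norm ?divr_ge0 ?(ltW m0)// -/n divfK// gt_eqF.
have zy : N (z - y) = m - n.
  rewrite (_ : z - y = ((m - n) / n) *: y).
    rewrite equivalent_normZ ger0_norm ?divr_ge0 ?subr_ge0// -/n divfK// gt_eqF//.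
  by rewrite mulrBl scalerBl divff ?gt_eqF// scale1r.
have ez : 3 / 4 * e <= N (x - z).
  have := equivalent_normD (x - z) (z - y); rewrite zy addrA subrK -/e; lra.
have mid : N (2^-1 *: (x + z)) <= m - a * N (x - z) ^+ 2 / m.
  by apply: modulus_midpoint => //; rewrite Nz.
have split_mid : 2^-1 *: (x + y) =
    (n / m) *: (2^-1 *: (x + z)) + ((m - n) / (2 * m)) *: x.
  rewrite /z !scalerDr !scalerA addrAC -scalerDl.
  by congr (_ *: _ + _ *: _); field; rewrite ?gt_eqF.
have Pm : P <= n / m * (m - a * N (x - z) ^+ 2 / m) + (m - n) / 2.
  rewrite /P split_mid (le_trans (equivalent_normD _ _))// lerD//.
    rewrite equivalent_normZ ger0_norm ?divr_ge0 ?(ltW m0)//.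
    by rewrite ler_wpM2l// divr_ge0// ltW.
  rewrite equivalent_normZ -/m ger0_norm; last first.
    by rewrite divr_ge0 ?subr_ge0// mulr_ge0// ltW.
  by rewrite le_eqVlt; apply/orP; left; apply/eqP; field; rewrite gt_eqF.
have ez2 : e ^+ 2 / 2 <= N (x - z) ^+ 2.
  have : (3 / 4 * e) ^+ 2 <= N (x - z) ^+ 2.
    by rewrite ler_pXn2r ?nnegrE// mulr_ge0// divr_ge0.
  have := sqr_ge0 e; nra.
have mP : m * P <= m * ((m + n) / 2) - a / 4 * e ^+ 2.
  have : m * P <= m * (n / m * (m - a * N (x - z) ^+ 2 / m) + (m - n) / 2).
    by rewrite ler_pM2l.
  rewrite [X in _ <= X -> _](_ : _ =
      m * ((m + n) / 2) - n / m * (a * N (x - z) ^+ 2)); last first.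
    by field; rewrite gt_eqF.
  move=> /le_trans; apply; rewrite lerD2l lerN2.
  apply: (@le_trans _ _ (2^-1 * (a * (e ^+ 2 / 2)))); first by lra.
  apply: ler_pM; rewrite ?invr_ge0//.
  - by rewrite mulr_ge0 ?(ltW a0)// divr_ge0// sqr_ge0.
  - by rewrite ler_pdivlMr//; lra.
  - by rewrite ler_wpM2l// ltW.
have ae : 0 <= a / 8 * e ^+ 2 by rewrite mulr_ge0 ?sqr_ge0// divr_ge0// ltW.
have PP : P ^+ 2 <= ((m + n) / 2) ^+ 2 - a / 8 * e ^+ 2.
  have h1 : P * P <= (m + n) / 2 * P by rewrite ler_wpM2r.
  have h2 : (m + n) / 2 * P * m <=
      (m + n) / 2 * (m * ((m + n) / 2) - a / 4 * e ^+ 2).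
    by rewrite -mulrA [P * m]mulrC ler_wpM2l// divr_ge0// addr_ge0// ltW.
  rewrite -(ler_pM2r m0) expr2.
  have h3 : P * P * m <= (m + n) / 2 * P * m by rewrite ler_wpM2r// ltW.
  apply: le_trans h3 _; apply: le_trans h2 _.
  have : n * (a / 8 * e ^+ 2) >= 0 by rewrite mulr_ge0.
  by rewrite -subr_ge0 => h4; rewrite -subr_ge0; lra.
have := ke _ k8; have := sqr_ge0 (m - n); nra.
Qed.

(** [w] is also the combination of the midpoints of [x, w] and of [y, w]. Convexity of [N ^ 2] and
    the midpoint inequality leave half of [N w ^ 2] on the right; clearing it doubles the
    constant. *)
Lemma sqr_norm_gap :
  modulus_power_type2 N ->
  exists2 k : R, 0 < k & forall (s t : R) x y w,
    0 <= s -> 0 <= t -> s + t = 1 -> w = s *: x + t *: y ->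
    k * (s * N (x - w) ^+ 2 + t * N (y - w) ^+ 2)
      <= s * N x ^+ 2 + t * N y ^+ 2 - N w ^+ 2.
Proof.
move=> /sqr_norm_midpoint[k k0 hk]; exists (2 * k); first by rewrite mulr_gt0.
move=> s t x y w s0 t0 st wE.
have wmid : w = s *: (2^-1 *: (x + w)) + t *: (2^-1 *: (y + w)).
  have ww : 2^-1 *: (w + w) = w.
    by rewrite -mulr2n -[w *+ 2]scaler_nat scalerA mulVf ?scale1r// pnatr_eq0.
  rewrite -{1}ww (scalerA s) (scalerA t) ![_ * 2^-1]mulrC -!scalerA -scalerDr.
  by rewrite (scalerDr s) (scalerDr t) addrACA -wE -scalerDl st scale1r.
have := sqr_norm_convex (2^-1 *: (x + w)) (2^-1 *: (y + w)) s0 t0 st.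
rewrite -wmid.
have : s * N (2^-1 *: (x + w)) ^+ 2 <=
    s * ((N x ^+ 2 + N w ^+ 2) / 2 - k * N (x - w) ^+ 2) by rewrite ler_wpM2l.
have : t * N (2^-1 *: (y + w)) ^+ 2 <=
    t * ((N y ^+ 2 + N w ^+ 2) / 2 - k * N (y - w) ^+ 2) by rewrite ler_wpM2l.
have -> : t = 1 - s by lra.
lra.
Qed.

End EquivalentNorm.

(** * Mappings with Lipschitz derivative *)

(** The real mean value theorem is applied to [l \o G] along the segment from [b] to [a]. *)
Lemma mean_value (R : realType) (Y Z : normedModType R) (U : set Y)
    (G : Y -> Z) (l : {linear Z -> R^o}) (a b : Y) :
  convex_set (U : set (convex_lmodType Y)) -> continuous l ->
  (forall x, U x -> differentiable G x) -> U a -> U b ->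
  exists tau : R, [/\ 0 <= tau, tau <= 1, U (b + tau *: (a - b)) &
    l (G a) - l (G b) = l ('d G (b + tau *: (a - b)) (a - b))].
Proof.
move=> cU lc dG Ua Ub; pose h (tau : R) := b + tau *: (a - b).
have Uh tau : 0 <= tau -> tau <= 1 -> U (h tau).
  move=> t0 t1; have s0 : 0 <= 1 - tau by rewrite subr_ge0.
  have := convex_setP cU s0 t0 (subrK _ _) Ub Ua; congr U.
  by rewrite /h scalerBl scalerBr scale1r addrA addrAC.
have hd (tau : R) : differentiable (h : R^o -> Y) tau /\
    'd (h : R^o -> Y) tau = (fun s : R^o => s *: (a - b)) :> (R^o -> Y).
  have hi : is_diff (tau : R^o) (h : R^o -> Y) (fun s : R^o => s *: (a - b)).
    have := is_diffD (is_diff_cst b (tau : R^o)) (is_diff_scalel tau (a - b)).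
    by rewrite add0r.
  by split; [exact: ex_diff|exact: diff_val].
have dphi (tau : R) : 0 <= tau -> tau <= 1 ->
    is_derive (tau : R^o) 1 (l \o G \o h : R^o -> R^o) (l ('d G (h tau) (a - b))).
  move=> t0 t1; have [dh dhE] := hd tau.
  have dGh : differentiable G (h tau) by apply: dG; exact: Uh.
  have dl : differentiable l (G (h tau)) by exact: linear_differentiable.
  have dlG : differentiable (l \o G) (h tau) by exact: differentiable_comp.
  have dlGh : differentiable (l \o G \o h : R^o -> R^o) tau.
    exact: differentiable_comp.
  apply: DeriveDef; first exact: diff_derivable.
  rewrite deriveE// diff_comp//= dhE/= scale1r diff_comp//=.
  by rewrite (diff_lin _ lc).
have [||tau /[!in_itv]/andP[t0 t1]] := @MVT R (l \o G \o h)
    (fun tau => l ('d G (h tau) (a - b))) 0 1 ltr01.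
- by move=> tau /[!in_itv]/andP[t0 t1]; apply: dphi; exact: ltW.
- apply: derivable_within_continuous => tau /[!in_itv]/andP[t0 t1].
  by have := dphi tau t0 t1; case.
have h1 : h 1 = a by rewrite /h scale1r addrC subrK.
have h0 : h 0 = b by rewrite /h scale0r addr0.
rewrite subr0 mulr1 /= h1 h0 => E.
exists tau; split; rewrite ?ltW//; apply: Uh; exact: ltW.
Qed.

Lemma C11_on_le (R : realType) (Y Z : normedModType R) (U : set Y) (G : Y -> Z) :
  C11_on U G -> exists2 L : R, 0 <= L &
    forall x y v, U x -> U y -> `|'d G x v - 'd G y v| <= L * `|x - y| * `|v|.
Proof.
move=> [dG [L hL]]; exists (Num.max L 0); first by rewrite le_max lexx orbT.
move=> x y v Ux Uy.
have [C1 _ h1] := continuous_linear_le (diff_continuous (dG x Ux)).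
have [C2 _ h2] := continuous_linear_le (diff_continuous (dG y Uy)).
have dZ (k : R) u : 'd G x (k *: u) - 'd G y (k *: u) = k *: ('d G x u - 'd G y u).
  by rewrite (linearZZ ('d G x)) (linearZZ ('d G y)) scalerBr.
have dC u : `|'d G x u - 'd G y u| <= (C1 + C2) * `|u|.
  by rewrite (le_trans (ler_normB _ _))// mulrDl lerD.
apply: le_trans (le_op_norm dZ dC v) _; rewrite ler_wpM2r//.
apply: le_trans (hL x y Ux Uy) _; rewrite ler_wpM2r//.
by rewrite le_max lexx.
Qed.

Lemma C11_taylor (R : realType) (Y Z : normedModType R) (U : set Y) (G : Y -> Z) :
  convex_set (U : set (convex_lmodType Y)) -> C11_on U G ->
  exists2 L : R, 0 <= L & forall (l : {linear Z -> R^o}) a b,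
    continuous l -> op_norm l <= 1 -> U a -> U b ->
    `|l (G a) - l (G b) - l ('d G b (a - b))| <= L * `|a - b| ^+ 2.
Proof.
move=> cU GU; have [L L0 hL] := C11_on_le GU; exists L => //.
move=> l a b lc l1 Ua Ub.
have [tau [t0 t1 Ux ->]] := mean_value cU lc GU.1 Ua Ub.
rewrite -linearB (le_trans (dual_ball_le _ lc l1))// (le_trans (hL _ _ _ Ux Ub))//.
rewrite addrAC subrr add0r normrZ ger0_norm// expr2 !mulrA ler_wpM2r//.
by rewrite -mulrA ler_wpM2l// ler_piMl.
Qed.

(** On the bounded set [U] all derivatives stay within [L * (r + r)] of the derivative at one point
    [c]. *)
Lemma C11_lipschitz (R : realType) (Y Z : normedModType R) (U : set Y)
    (G : Y -> Z) (r : R) :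
  convex_set (U : set (convex_lmodType Y)) -> C11_on U G ->
  (forall y, U y -> `|y| <= r) ->
  exists M : R, forall (l : {linear Z -> R^o}) a b,
    continuous l -> op_norm l <= 1 -> U a -> U b ->
    `|l (G a) - l (G b)| <= M * `|a - b|.
Proof.
move=> cU GU Ur; have [U0|/set0P[c Uc]] := eqVneq U set0.
  by exists 0 => l a b _ _; rewrite U0.
have [L L0 hL] := C11_on_le GU.
have [C _ hC] := continuous_linear_le (diff_continuous (GU.1 c Uc)).
exists (C + L * (r + r)) => l a b lc l1 Ua Ub.
have [tau [t0 t1 Ux ->]] := mean_value cU lc GU.1 Ua Ub.
set x := _ + _ in Ux *; rewrite (le_trans (dual_ball_le _ lc l1))//.
rewrite -[X in `|X|](subrK ('d G c (a - b))) (le_trans (ler_normD _ _))//.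
rewrite addrC mulrDl lerD// (le_trans (hL _ _ _ Ux Uc))// ler_wpM2r// ler_wpM2l//.
by rewrite (le_trans (ler_normB _ _))// lerD// Ur.
Qed.

(** * A control function in case (c) *)

(** Convexity carries the minorant from the point at parameter [1 / (1 + e)] of the segment, at
    distance at most 1 from [b], to its end [a]. *)
Lemma convex_local_slope (R : realType) (Y : normedModType R) (B : set Y)
    (k : Y -> R^o) (b : Y) (L : R) :
  convex_set (B : set (convex_lmodType Y)) ->
  convex_function (B : set (convex_lmodType Y)) k -> B b ->
  (forall a, B a -> `|a - b| <= 1 -> k b - L * `|a - b| <= k a) ->
  forall a, B a -> k b - L * `|a - b| <= k a.
Proof.
move=> cB /convex_functionP ck Bb kL a Ba; set e := `|a - b|.
have e0 : 0 <= e by exact: normr_ge0.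
have e1 : 0 < 1 + e by lra.
pose t := (1 + e)^-1; have t0 : 0 < t by rewrite invr_gt0.
have t1 : t <= 1 by rewrite invf_le1//; lra.
have s0 : 0 <= 1 - t by lra.
have st : 1 - t + t = 1 by lra.
have E : (1 - t) *: b + t *: a - b = t *: (a - b).
  by rewrite scalerBl scale1r scalerBr addrAC (addrAC b) subrr add0r addrC.
have En : `|(1 - t) *: b + t *: a - b| = t * e.
  by rewrite E normrZ gtr0_norm.
have te : t * e <= 1 by rewrite mulrC ler_pdivrMr//; lra.
have := kL _ (convex_setP cB s0 (ltW t0) st Bb Ba).
rewrite En => /(_ te) h1; have h2 := ck _ _ _ _ s0 (ltW t0) st Bb Ba.
rewrite -(ler_pM2l t0); lra.
Qed.

Lemma convex_ball_setI (R : realType) (Y : normedModType R) (B : set Y) (r : R) :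
  convex_set (B : set (convex_lmodType Y)) ->
  convex_set (B `&` [set y | `|y| < r] : set (convex_lmodType Y)).
Proof.
move=> cB x y t /set_mem[Bx xr] /set_mem[By yr]; apply/mem_set; split.
  by apply: set_mem; apply: cB; apply: mem_set.
rewrite /= in xr yr *.
have t0 : 0 <= t%:num by [].
have t1 : 0 <= 1 - t%:num by rewrite subr_ge0 le1.
apply: le_lt_trans (ler_normD _ _) _; rewrite !normrZ (ger0_norm t0) (ger0_norm t1).
have [-> | tn0] := eqVneq t%:num 0; first by rewrite mul0r add0r subr0 mul1r.
have tp : 0 < t%:num by rewrite lt_neqAle eq_sym tn0.
have : t%:num * `|x : Y| < t%:num * r by rewrite ltr_pM2l.
have : (1 - t%:num) * `|y : Y| <= (1 - t%:num) * r by rewrite ler_wpM2l// ltW.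
lra.
Qed.

Lemma open_ball_setI (R : realType) (Y : normedModType R) (B : set Y) (r : R) :
  open B -> open (B `&` [set y | `|y| < r]).
Proof.
move=> oB; apply: openI => //.
apply: (@open_comp _ _ (fun y : Y => `|y|) [set x | x < r]).
  by move=> y _; exact: norm_continuous.
exact: open_lt.
Qed.

Lemma bounded_ball_setI (R : realType) (Y : normedModType R) (B : set Y) (r : R) :
  bounded_set (B `&` [set y | `|y| < r]).
Proof.
exists r; rewrite num_real; split=> // x rx y [_ /= yr].
exact: ltW (lt_trans yr rx).
Qed.

(* The Taylor remainder of [l \o G] at [w] is compared with the gap at [N w ^ 2]
   of a hinge sum [psi]: points [a] with [N a ^ 2 <= N w ^ 2 + 2] are handled by
   the slope of [psi] and the uniform convexity of [N ^ 2], the other ones by the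
   hinge at [trunc (N a ^ 2) - 1]. *)
Lemma C11_control (R : realType) (Y Z : normedModType R) (B : set Y)
    (G : Y -> Z) (N : Y -> R) :
  open B -> convex_set (B : set (convex_lmodType Y)) ->
  equivalent_norm N -> modulus_power_type2 N ->
  (forall U : set Y, open U -> bounded_set U -> U `<=` B -> C11_on U G) ->
  exists2 g : Y -> R^o, control_function B G g &
    forall n : nat, exists L, forall b, B b -> `|b| <= n%:R ->
      slope_bound B G g L b.
Proof.
move=> oB cB eqN mN C11G; have N0 := equivalent_norm_ge0 eqN.
have [k k0 gapN] := sqr_norm_gap eqN mN.
have [_ _ _ [c [C [c0 C0 cNC]]]] := eqN.
pose U r := B `&` [set y : Y | `|y| < r].
have UC11 r : C11_on (U r) G.
  apply: C11G; [exact: open_ball_setI|exact: bounded_ball_setI|by move=> ? []].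
have cU r : convex_set (U r : set (convex_lmodType Y)) by exact: convex_ball_setI.
pose u y := N y ^+ 2; have u0 y : 0 <= u y by exact: sqr_ge0.
pose rem (l : {linear Z -> R^o}) a w := l (G a) - l (G w) - l ('d G w (a - w)).
have /choice[Lam LamP] : forall n : nat, exists L : R, 0 <= L /\
    forall (l : {linear Z -> R^o}) a w, continuous l -> op_norm l <= 1 ->
      B a -> B w -> u a <= n%:R -> u w <= n%:R ->
      `|rem l a w| <= L * u (a - w).
  (* [u a <= n] gives [N a <= n + 1], hence |a| <= (n + 1) / c; the last 1 makes the inequality
     strict. *)
  move=> n; have [L L0 hL] := C11_taylor (cU ((n%:R + 1) / c + 1)) (UC11 _).
  exists (L / c ^+ 2); split; first by rewrite divr_ge0// sqr_ge0.
  have inU a : B a -> u a <= n%:R -> U ((n%:R + 1) / c + 1) a.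
    move=> Ba an; split=> //=.
    apply: (@le_lt_trans _ _ ((n%:R + 1) / c)); last by lra.
    rewrite ler_pdivlMr// mulrC (le_trans (cNC a).1)//.
    by move: an; rewrite /u; have := sqr_ge0 (N a - 1); nra.
  move=> l a w lc l1 Ba Bw an wn.
  apply: le_trans (hL l a w lc l1 (inU a Ba an) (inU w Bw wn)) _.
  rewrite mulrAC -mulrA ler_wpM2l// ler_pdivlMr ?exprn_gt0// -exprMn.
  rewrite ler_pXn2r ?nnegrE ?mulr_ge0 ?(ltW c0)//.
  by rewrite mulrC; exact: (cNC _).1.
(* The first term serves near points, where [u a < j + 3]; the second is the hinge weight absorbing
   the remainder at far points. *)
pose L j := Lam j.+3 / k + 4 * (j%:R + 2) * Lam j.+2.
have Lam0 n : 0 <= Lam n by case: (LamP n).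
have L1 j : 0 <= Lam j.+3 / k by rewrite divr_ge0// ltW.
have L2 j : 0 <= 4 * (j%:R + 2) * Lam j.+2.
  by rewrite mulr_ge0// mulr_ge0// addr_ge0.
have [j|psi [sigma [psiS sigmaM sigma0 sigmaL psiH]]] := @hinge_sum R L.
  by rewrite addr_ge0.
(* [E w r] is the excess of [psi] over its tangent at [u w]. *)
pose E w r := psi r - psi (u w) - sigma (u w) * (r - u w).
have remP (l : {linear Z -> R^o}) a w : continuous l -> op_norm l <= 1 ->
    B a -> B w -> - rem l a w <= E w (u a) + sigma (u w) * (k * u (a - w)).
  move=> lc l1 Ba Bw; apply: le_trans (ler_norm _) _; rewrite normrN.
  have E0 : 0 <= E w (u a) by have := psiS (u w) (u a); rewrite /E; lra.
  have ku0 : 0 <= k * u (a - w) by rewrite mulr_ge0// ltW.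
  have [near|far] := leP (u a) (u w + 2).
    set j := Num.truncn (u w).
    have uj : u w < j%:R + 1 by rewrite natr1 truncnS_gt.
    have j3 : (j.+3)%:R = j%:R + 3 :> R by rewrite -addn3 natrD.
    have := (LamP j.+3).2 l a w lc l1 Ba Bw; rewrite j3 => H.
    apply: le_trans (H _ _) _; [lra|lra|].
    have : Lam j.+3 / k <= sigma (u w).
      by apply: le_trans (sigmaL _ (u0 w)); rewrite /L lerDl.
    move=> /(ler_wpM2r ku0).
    rewrite (_ : _ / k * _ = Lam j.+3 * u (a - w)); first lra.
    by field; rewrite gt_eqF.
  have ua2 : 2 <= u a by have := u0 w; lra.
  (* The hinge at [m + 1] lies above [u w] and at least 1 below [u a], so it contributes at least
     [L m.+1] to the excess. *)
  have [m mE] : exists m, Num.truncn (u a) = m.+2.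
    have : (2 <= Num.truncn (u a))%N by rewrite truncn_ge_nat.
    by case: (Num.truncn _) => [//|[//|m _]]; exists m.
  have /andP[] := truncn_itv (u0 a); rewrite mE => um um'.
  have m2 : (m.+2)%:R = m%:R + 2 :> R by rewrite -addn2 natrD.
  have m3 : (m.+3)%:R = m%:R + 3 :> R by rewrite -addn3 natrD.
  have m1 : (m.+1)%:R = m%:R + 1 :> R by rewrite -addn1 natrD.
  rewrite m2 in um; rewrite m3 in um'.
  have := (LamP m.+3).2 l a w lc l1 Ba Bw; rewrite m3 => H.
  apply: le_trans (H _ _) _; [lra|lra|].
  have uaw : u (a - w) <= 4 * u a.
    have h1 : N (a - w) <= N a + N w.
      by rewrite -(equivalent_normN eqN w); exact: equivalent_normD.
    have h2 : u (a - w) <= (N a + N w) ^+ 2.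
      by rewrite ler_pXn2r ?nnegrE// ?addr_ge0.
    have := sqr_ge0 (N a - N w); move: far h2; rewrite /u; nra.
  have := psiH (u w) m.+1 (u a); rewrite m1 => H'.
  have {}H' := H' ltac:(lra) ltac:(lra).
  have Lm : L m.+1 <= E w (u a).
    have : L m.+1 * 1 <= L m.+1 * (u a - (m%:R + 1)).
      by rewrite ler_wpM2l ?addr_ge0//; lra.
    rewrite /E; lra.
  have : Lam m.+3 * u (a - w) <= 4 * (m.+1%:R + 2) * Lam m.+3.
    by rewrite [leRHS]mulrC ler_wpM2l// m1; lra.
  have := L1 m.+1; have : 0 <= sigma (u w) * (k * u (a - w)) by rewrite mulr_ge0.
  move: Lm; rewrite /L; lra.
have Gg : control_function B G (psi \o u).
  split.
    apply: continuous_subspaceT => y.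
    apply: continuous_comp; last exact: subgradient_continuous.
    by apply: (@continuousM R Y N N); exact: equivalent_norm_continuous.
  move=> l lc l1; apply/convex_functionP => s t x y s0 t0 st Bx By /=.
  set w := s *: x + t *: y; have Bw : B w by exact: (convex_setP cB).
  have remx : s * (- rem l x w) <= s * (E w (u x) + sigma (u w) * (k * u (x - w))).
    by rewrite ler_wpM2l// remP.
  have remy : t * (- rem l y w) <= t * (E w (u y) + sigma (u w) * (k * u (y - w))).
    by rewrite ler_wpM2l// remP.
  have gap : sigma (u w) * (k * (s * u (x - w) + t * u (y - w))) <=
      sigma (u w) * (s * u x + t * u y - u w) by rewrite ler_wpM2l// gapN.
  (* The first-order terms cancel because [w] is the barycentre. *)
  have lin0 : s * l ('d G w (x - w)) + t * l ('d G w (y - w)) = 0.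
    have : l ('d G w (s *: (x - w) + t *: (y - w))) = 0.
      rewrite !scalerBr addrACA -opprD -scalerDl st scale1r subrr.
      by rewrite (raddf0 ('d G w)) (raddf0 l).
    by rewrite (linearD ('d G w)) !(linearZZ ('d G w)) linearD !(linearZZ l).
  have Et : t = 1 - s by lra.
  move: remx remy gap lin0; rewrite /E /rem Et; lra.
exists (psi \o u) => // n.
(* This radius keeps [b] and every [a] within 1 of it inside the open ball; [P] below bounds
   [N b]. *)
pose r : R := n%:R + 2; have r0 : 0 < r by rewrite ltr_wpDl.
have [M hM] := C11_lipschitz (cU r) (UC11 r) (fun y Uy => ltW Uy.2).
pose P := C * r; have P0 : 0 <= P by rewrite mulr_ge0 ?ltW.
exists (M + sigma (P ^+ 2) * (2 * P * C)) => b Bb bn l lc l1.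
apply: (convex_local_slope cB (Gg.2 l lc l1) Bb) => a Ba ab.
have br : `|b| < r by rewrite /r; lra.
have ar : `|a| < r by have := ler_normD (a - b) b; rewrite subrK /r; lra.
have := hM l a b lc l1 (conj Ba ar) (conj Bb br).
rewrite distrC => /ler_normlW lGab.
have NP : N b <= P by rewrite (le_trans (cNC b).2)// ler_wpM2l//; exact: ltW.
have ubP : u b <= P ^+ 2 by rewrite ler_pXn2r ?nnegrE.
have uab : u b - u a <= 2 * P * C * `|a - b|.
  have h1 : N b - N a <= C * `|a - b|.
    rewrite (le_trans (equivalent_norm_dist eqN _ _))// (equivalent_normB eqN).
    exact: (cNC _).2.
  have h2 : N b * (N b - N a) <= P * (C * `|a - b|).
    apply: (@le_trans _ _ (N b * (C * `|a - b|))); first by rewrite ler_wpM2l.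
    by rewrite ler_wpM2r// mulr_ge0// ltW.
  by have := sqr_ge0 (N b - N a); rewrite /u; nra.
have psiab : psi (u b) - psi (u a) <= sigma (P ^+ 2) * (2 * P * C * `|a - b|).
  have := psiS (u b) (u a).
  have : sigma (u b) * (u b - u a) <= sigma (u b) * (2 * P * C * `|a - b|).
    by rewrite ler_wpM2l.
  have : sigma (u b) * (2 * P * C * `|a - b|) <=
      sigma (P ^+ 2) * (2 * P * C * `|a - b|).
    rewrite ler_wpM2r ?sigmaM//.
    by rewrite mulr_ge0// mulr_ge0 ?(ltW C0)// mulr_ge0.
  lra.
move: lGab psiab; rewrite /=; lra.
Qed.

Theorem theorem3p6 (R : realType) (X Y Z : normedModType R)
    (A : set X) (B : set Y) (F : X -> Y) (G : Y -> Z)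
    (openA : open A) (convexA : convex_set (A : set (convex_lmodType X)))
    (openB : open B) (convexB : convex_set (B : set (convex_lmodType Y)))
    (FAB : set_fun A B F)
    (dcF : delta_convex A F) (dcG : delta_convex B G)
    (cond :
      [\/ B = [set: Y] /\
          (exists2 g : Y -> R^o,
             control_function B G g & bounded_on_bounded_sets g),
          finite_dimensional Y /\ closure (F @` A) `<=` B
        | (exists2 N : Y -> R, equivalent_norm N & modulus_power_type2 N) /\
          (forall U : set Y, open U -> bounded_set U -> U `<=` B ->
             C11_on U G)]) :
  delta_convex A (G \o F).
Proof.
have [cG [g0 Gg0]] := dcG.
case: cond => [[BT [g Gg bg]]|[fdY FB]|[[N eqN mN] C11G]].
- apply: (delta_convex_comp_slope _ _ _ _ FAB dcF cG Gg) => // n.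
  rewrite BT in cG Gg *; have [L hL] := slope_bound_bounded n cG Gg bg.
  by exists L => b _; exact: hL.
- apply: (delta_convex_comp_slope _ _ _ _ FAB dcF cG Gg0) => // n.
  have [K cK hK] := finite_dimensional_bounded_compact n%:R fdY.
  (* The closure hypothesis makes this bounded closed set a compact subset of [B]. *)
  have [||L hL] := @slope_bound_compact _ _ _ B
    (closure (F @` A) `&` [set y | `|y| <= n%:R]) G g0 openB cG Gg0.
  + apply: subclosed_compact cK _; last by move=> y [_]; exact: hK.
    apply: closedI; first exact: closed_closure.
    apply: (@closed_comp _ _ (fun y : Y => `|y|) [set x | x <= n%:R]).
      by move=> y _; exact: norm_continuous.
    exact: closed_le.
  + by move=> y [/FB].
  + by exists L => b Fb bn; apply: hL; split=> //; exact: subset_closure.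
(* The given control function [g0] is replaced by one with slope bounds on bounded sets. *)
- have [g Gg hg] := C11_control openB convexB eqN mN C11G.
  apply: (delta_convex_comp_slope _ _ _ _ FAB dcF cG Gg) => // n.
  have [L hL] := hg n; exists L => _ [x Ax <-]; apply: hL.
  exact: FAB.
Qed.
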